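(* Let $p\ge 2$, $\alpha\geq 2$ and $\beta\ge 1$ be integers. A DAV correspondence with parameters $p,\alpha,\beta$ has pairwise distinct rows if and only if $\beta\geq \alpha-2$.
   Context: There are two voters. $A$ is a set of $p$ candidates; the first voter has $\alpha$ voting cards and the second has $\beta$ voting cards ($\alpha,\beta$ positive integers). The sets of voting strategies are $X=\{x\in\mathbb{Z}_{\ge 0}^A : \sum_{a\in A}x_a=\alpha\}$ and $Y=\{y\in\mathbb{Z}_{\ge 0}^A : \sum_{a\in A}y_a=\beta\}$, with $k=|X|=\binom{\alpha+p-1}{p-1}$ and $\ell=|Y|=\binom{\beta+p-1}{p-1}$. For $z\in\mathbb{Z}^A$ let $AM(z)=\{a\in A : z_a=\max_{c\in A}z_c\}$. A matrix $h\in(2^A)^{k\times\ell}$ is a distributed approval voting correspondence (DAV correspondence) with parameters $p,\alpha,\beta$ if the strategies can be labeled bijectively as $X=\{x^1,\dots,x^k\}$, $Y=\{y^1,\dots,y^\ell\}$ such that $h(i,j)=AM(x^i+y^j)$ for all $i=1,\dots,k$, $j=1,\dots,\ell$. For given parameters it is unique up to permutations of rows and columns. *)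

(* Defs.v *)
From HB Require Import structures.
From mathcomp Require Import all_boot all_order all_algebra.

Set Implicit Arguments.
Unset Strict Implicit.
Unset Printing Implicit Defensive.

Import Order.TTheory GRing.Theory Num.Theory.
Local Open Scope ring_scope.

Definition voting_strategy (A : finType) (n : nat) (x : {ffun A -> int}) : Prop :=
  (forall a : A, 0 <= x a) /\ \sum_(a : A) x a = n%:Z.

Definition num_strategies (p n : nat) : nat := 'C(n + p - 1, p - 1).

Definition strategy_labeling (A : finType) (n k : nat)
    (x : 'I_k -> {ffun A -> int}) : Prop :=
  injective x /\
  forall z : {ffun A -> int}, voting_strategy n z <-> exists i : 'I_k, x i = z.

(* The initial value z a is one of the terms, so the big operator is the maximum
   of z over A, including when all entries of z are negative. *)
Definition AM (A : finType) (z : {ffun A -> int}) : {set A} :=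
  [set a : A | z a == \big[Order.max/z a]_(c : A) z c].

Definition DAV_correspondence (A : finType) (p alpha beta : nat)
    (h : 'M[{set A}]_(num_strategies p alpha, num_strategies p beta)) : Prop :=
  exists (x : 'I_(num_strategies p alpha) -> {ffun A -> int})
         (y : 'I_(num_strategies p beta) -> {ffun A -> int}),
    [/\ strategy_labeling alpha x,
        strategy_labeling beta y &
        forall i j, h i j = AM (x i + y j)].

Definition pairwise_distinct_rows (T : Type) (k l : nat) (h : 'M[T]_(k, l)) : Prop :=
  forall i i' : 'I_k, i != i' -> row i h <> row i' h.

(* Main.v *)
Require Import Defs.
From HB Require Import structures.
From mathcomp Require Import all_boot all_order all_algebra.
From mathcomp Require Import zify.

(** If [beta < alpha - 2], a first voter who gives [alpha] or [alpha - 1] cards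
    to [a] makes [a] the only winner, wherever the other cards go, so these
    strategies cannot be told apart.

    Conversely let [x] and [x'] be distinct strategies of the first voter and
    [alpha - 2 <= beta]. Suppose first that some candidate [c] maximizes [x] and
    satisfies [x c <= x' c]. Pick [a] with [x' a < x a]. Then [x a >= 1], hence
    [x c - x a <= alpha - 2 <= beta], and the second voter can lift [a] to a tie
    with [c] under [x]; under [x'] the candidate [a] then loses to [c].
    By symmetry one may now assume that every maximizer [a] of [x] has
    [x' a < x a] and every maximizer [b] of [x'] has [x b < x' b]. Sharing the
    [beta] cards between [a] and [b], as evenly as possible and with an odd card
    going to [a], makes [b] win under [x'] but not under [x]. *)

Set Implicit Arguments.
Unset Strict Implicit.
Unset Printing Implicit Defensive.

Import Order.TTheory GRing.Theory Num.Theory.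
Local Open Scope ring_scope.

Section Strategies.
Variable A : finType.
Implicit Types (x y z : {ffun A -> int}) (a b c : A).

Lemma AMP z a : reflect (forall c, z c <= z a) (a \in AM z).
Proof.
rewrite inE; apply: (iffP eqP) => [-> c | max_a]; first exact: le_bigmax.
apply/le_anti; rewrite bigmax_ge_id /=.
by apply: bigmax_le => // c _; exact: max_a.
Qed.

Lemma AM_nonempty a0 z : exists a, a \in AM z.
Proof.
case: (@arg_maxP _ _ _ a0 xpredT z) => // a _ max_a.
by exists a; apply/AMP => c; exact: max_a.
Qed.

(** A single better rival [c] already rules [a] out under [z']. *)
Lemma AM_neq z z' a c : a \in AM z -> z' a < z' c -> AM z <> AM z'.
Proof.
by move=> az lt_ac eqAM; move: az; rewrite eqAM => /AMP/(_ c); rewrite leNgt lt_ac.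
Qed.

Lemma AM_unique z a : (forall c, c != a -> z c < z a) -> AM z = [set a].
Proof.
move=> lt_a; apply/setP => c; rewrite [RHS]inE; apply/AMP/eqP => [|->] e.
  by apply/eqP; apply: contraTT (e a) => /lt_a; rewrite -ltNge.
by have [-> | /lt_a/ltW] := eqVneq e a.
Qed.

(* Unlike [ffunE], this leaves the entries in the syntactic form that [lia] can
   match with the entries of [x] and [y] in the hypotheses. *)
Lemma ffunDE x y a : (x + y) a = x a + y a.
Proof. by rewrite ffunE. Qed.

Definition votes_for (n : nat) a : {ffun A -> int} :=
  [ffun c => if c == a then n%:Z else 0].

Lemma voting_strategy_votes_for n a : voting_strategy n (votes_for n a).
Proof.
split=> [c|]; first by rewrite ffunE; case: ifP.
rewrite (bigD1 a) //= ffunE eqxx big1 ?addr0 // => c /negbTE ca.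
by rewrite ffunE ca.
Qed.

Lemma voting_strategyD m n x y :
  voting_strategy m x -> voting_strategy n y -> voting_strategy (m + n) (x + y).
Proof.
move=> [x0 sx] [y0 sy]; split=> [a|]; first by rewrite ffunE addr_ge0.
under eq_bigr do rewrite ffunE.
by rewrite big_split /= sx sy PoszD.
Qed.

Lemma voting_strategy_le2 n x a b :
  voting_strategy n x -> a != b -> x a + x b <= n%:Z.
Proof.
move=> [x0 <-] ab; rewrite (bigD1 a) //= (bigD1 b) 1?eq_sym //= addrA lerDl.
by apply: sumr_ge0 => c _; exact: x0.
Qed.

Lemma voting_strategy_le1 n x a : voting_strategy n x -> x a <= n%:Z.
Proof.
move=> [x0 <-]; rewrite (bigD1 a) //= lerDl.
by apply: sumr_ge0 => c _; exact: x0.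
Qed.

(** Otherwise [x' - x] is nonnegative with sum zero, hence vanishes. *)
Lemma voting_strategy_gt n x x' :
  voting_strategy n x -> voting_strategy n x' -> x != x' -> exists a, x' a < x a.
Proof.
move=> [_ sx] [_ sx'] neq; apply/existsP; apply: contraNT neq => /existsPn le_xx'.
have ge0 a : true -> 0 <= x' a - x a by rewrite subr_ge0 leNgt le_xx'.
have sum0 : \sum_a (x' a - x a) = 0 by rewrite sumrB sx sx' subrr.
apply/eqP/ffunP => a; apply/esym/eqP; rewrite -subr_eq0; apply/eqP.
exact: psumr_eq0P ge0 sum0 a isT.
Qed.

Lemma separate_of_tie alpha beta x x' c :
    voting_strategy alpha x -> voting_strategy alpha x' -> x != x' ->
    (alpha - 2 <= beta)%N -> c \in AM x -> x c <= x' c ->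
  exists2 y, voting_strategy beta y & AM (x + y) <> AM (x' + y).
Proof.
move=> vx vx' neq le_beta max_c le_c.
have [a lt_a] := voting_strategy_gt vx vx' neq.
have [b lt_b] : exists b, x b < x' b.
  by apply: voting_strategy_gt vx' vx _; rewrite eq_sym.
have ab : b != a by apply: contraTneq lt_b => ->; lia.
have ba : a != b by rewrite eq_sym.
(* Kept general in [d]: the tie is made with [b] in one case and with [c] in the other. It follows
   from [x d + x a <= alpha] and [1 <= x a]. *)
have lift_bound d : d != a -> x d - x a <= beta%:Z.
  move=> da; have := voting_strategy_le2 vx da.
  have [/(_ a) x'0 _] := vx'; lia.
have [x0 _] := vx.
move/AMP: max_c => max_c.
(* An odd card left over after the tie must not decide between [a] and [c]: it
   goes to [b], unless [b] is a maximizer; then [b] replaces [c], and the margin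
   of at least 2 coming from [b] and [a] absorbs the card. *)
have [eq_b | neq_b] := eqVneq (x b) (x c).
  have le_a := max_c a; have lift := lift_bound b ab.
  have [m mE] : exists m : nat, x b = x a + m%:Z by exists `|x b - x a|%N; lia.
  have [r rE] : exists r, beta = (m + r)%N by exists (beta - m)%N; lia.
  exists (votes_for (m + (r - r./2)) a + votes_for r./2 b).
    have -> : beta = (m + (r - r./2) + r./2)%N by lia.
    by apply: voting_strategyD; exact: voting_strategy_votes_for.
  apply: (@AM_neq _ _ a b); last first.
    by rewrite !ffunDE !ffunE !eqxx (negbTE ab) (negbTE ba); lia.
  apply/AMP => d; have := max_c d; rewrite !ffunDE !ffunE eqxx (negbTE ba).
  have [->|da] := eqVneq d a; first by rewrite (negbTE ba); lia.
  by have [->|db] := eqVneq d b; lia.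
have lt_bc : x b < x c by rewrite lt_neqAle neq_b max_c.
have bc : b != c by apply: contraNneq neq_b => ->.
have ca : c != a by apply: contraTneq le_c => ->; lia.
have le_a := max_c a; have lift := lift_bound c ca.
have [m mE] : exists m : nat, x c = x a + m%:Z by exists `|x c - x a|%N; lia.
have [r rE] : exists r, beta = (m + r)%N by exists (beta - m)%N; lia.
(* As [x b < x c], the odd card lifts [b] at most to the tied score. *)
exists (votes_for (m + r./2) a + votes_for r./2 c + votes_for (odd r) b).
  have -> : beta = (m + r./2 + r./2 + odd r)%N by lia.
  by do !apply: voting_strategyD; exact: voting_strategy_votes_for.
have [ac cb] : a != c /\ c != b by rewrite [a == c]eq_sym [c == b]eq_sym.
apply: (@AM_neq _ _ a c); last first.
  rewrite !ffunDE !ffunE !eqxx (negbTE ca) (negbTE ac) (negbTE ba) (negbTE cb); lia.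
apply/AMP => d; have := max_c d.
rewrite !ffunDE !ffunE eqxx (negbTE ac) (negbTE ba).
have [->|da] := eqVneq d a; first by rewrite (negbTE ac) (negbTE ba); lia.
have [->|dc] := eqVneq d c; first by rewrite (negbTE cb); lia.
by have [->|db] := eqVneq d b; lia.
Qed.

Lemma separate alpha beta x x' :
    voting_strategy alpha x -> voting_strategy alpha x' -> x != x' ->
    (alpha - 2 <= beta)%N ->
  exists2 y, voting_strategy beta y & AM (x + y) <> AM (x' + y).
Proof.
move=> vx vx' neq le_beta.
have [a0 _] := voting_strategy_gt vx vx' neq.
have [a max_a] := AM_nonempty a0 x; have [b max_b] := AM_nonempty a0 x'.
have [le_a | lt_a] := lerP (x a) (x' a).
  exact: separate_of_tie vx vx' neq le_beta max_a le_a.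
have [le_b | lt_b] := lerP (x' b) (x b).
  rewrite eq_sym in neq.
  have [y vy neqy] := separate_of_tie vx' vx neq le_beta max_b le_b.
  by exists y => // /esym.
have ab : b != a by apply: contraTneq lt_b => ->; lia.
have ba : a != b by rewrite eq_sym.
move/AMP: max_a => max_a; move/AMP: max_b => max_b.
(* If [b] also maximizes [x], it serves as the [c] of [separate_of_tie]; next, [a] does so with [x]
   and [x'] exchanged. *)
have [eq_ab | neq_ab] := eqVneq (x b) (x a).
  apply: separate_of_tie vx vx' neq le_beta _ (ltW lt_b).
  by apply/AMP => d; rewrite eq_ab.
have [eq_ba | neq_ba] := eqVneq (x' b) (x' a).
  rewrite eq_sym in neq.
  have max_a' : a \in AM x' by apply/AMP => d; rewrite -eq_ba.
  have [y vy neqy] := separate_of_tie vx' vx neq le_beta max_a' (ltW lt_a).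
  by exists y => // /esym.
have [le_ba le_ab] := (max_a b, max_b a).
(* Both gaps between [a] and [b] are now strict: the one under [x'] absorbs an odd card, the one
   under [x] keeps [b] behind when [beta] is even. *)
exists (votes_for (beta - beta./2) a + votes_for beta./2 b).
  have {1}-> : beta = (beta - beta./2 + beta./2)%N by lia.
  by apply: voting_strategyD; exact: voting_strategy_votes_for.
apply/nesym; apply: (@AM_neq _ _ b a); last first.
  rewrite !ffunDE !ffunE !eqxx (negbTE ab) (negbTE ba); lia.
apply/AMP => d; have := max_b d; rewrite !ffunDE !ffunE eqxx (negbTE ab).
have [->|da] := eqVneq d a; first by rewrite (negbTE ba); lia.
by have [->|db] := eqVneq d b; lia.
Qed.

(** A rival ends with at most [1 + beta] cards, fewer than the [alpha - 1] that [a] has from [x]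
    alone. *)
Lemma AM_dominant alpha beta x y a : (beta < alpha - 2)%N ->
    (alpha%:Z - 1 <= x a) -> (forall c, c != a -> x c <= 1) ->
  voting_strategy beta y -> AM (x + y) = [set a].
Proof.
move=> lt_beta ge_a le_c vy; apply: AM_unique => c ca; rewrite !ffunDE.
have := le_c c ca; have := voting_strategy_le1 c vy.
have [/(_ a) y0 _] := vy; lia.
Qed.

End Strategies.

Theorem theorem1 (p alpha beta : nat) (hp : (2 <= p)%N) (halpha : (2 <= alpha)%N)
    (hbeta : (1 <= beta)%N) (A : finType) (hA : #|A| = p)
    (h : 'M[{set A}]_(num_strategies p alpha, num_strategies p beta))
    (hDAV : DAV_correspondence h) :
  pairwise_distinct_rows h <-> (alpha - 2 <= beta)%N.
Proof.
case: hDAV => x [y [[x_inj x_onto] [_ y_onto] hE]].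
have vx i : voting_strategy alpha (x i) by apply/x_onto; exists i.
have vy j : voting_strategy beta (y j) by apply/y_onto; exists j.
split=> [distinct | le_beta i i' neq eq_row].
  rewrite leqNgt; apply/negP => lt_beta.
  have /card_gt1P[a [b [_ _ ab]]] : (1 < #|A|)%N by rewrite hA.
  have [i xi] := (x_onto _).1 (voting_strategy_votes_for alpha a).
  have [i' xi'] : exists i, x i = votes_for (alpha - 1) a + votes_for 1 b.
    apply/x_onto; have {1}-> : alpha = (alpha - 1 + 1)%N by lia.
    by apply: voting_strategyD; exact: voting_strategy_votes_for.
  apply: (distinct i i').
    (* The two strategies differ at [b], with 0 and 1 cards. *)
    apply/eqP => ii'; move/ffunP/(_ b): xi; rewrite ii' xi' !ffunE eqxx.
    by rewrite eq_sym (negbTE ab).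
  apply/rowP => j; rewrite !mxE !hE xi xi'.
  rewrite !(AM_dominant lt_beta (a := a) _ _ (vy j)) //.
  - by rewrite !ffunDE !ffunE eqxx (negbTE ab); lia.
  - by move=> c /negbTE ca; rewrite !ffunE ca; case: ifP.
  - by rewrite ffunE eqxx; lia.
  - by move=> c /negbTE ca; rewrite ffunE ca.
have neqx : x i != x i' by rewrite (inj_eq x_inj).
have [z vz] := separate (vx i) (vx i') neqx le_beta.
have [j <-] := (y_onto z).1 vz.
by move/rowP/(_ j): eq_row; rewrite !mxE !hE.
Qed.
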